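(* Let $\Gamma$ be a context, $\sigma$ a type, and $t,u$ classical QML terms. If $\Gamma\vdash t\equiv u:\sigma$ is derivable in the classical equational theory, then the functions $[\![\Gamma\vdash t:\sigma]\!]$ and $[\![\Gamma\vdash u:\sigma]\!]$ from $[\![\Gamma]\!]$ to $[\![\sigma]\!]$ are extensionally equal.
   Context: **Syntax.** Types: $\sigma::=\mathcal Q_1\mid\mathcal Q_2\mid\sigma\otimes\tau$. Patterns: $p::=x\mid(x,y)$. Classical terms: $t,u,e::=x\mid()\mid(t,u)\mid\mathbf{let}\ p=t\ \mathbf{in}\ u\mid\mathbf{if}^\circ\ t\ \mathbf{then}\ u\ \mathbf{else}\ u'\mid\mathrm{false}\mid\mathrm{true}$. Contexts: $\Gamma::=\bullet\mid\Gamma,x:\sigma$, each variable occurring at most once (finite functions from variables to types). The partial operation $\Gamma\otimes\Delta$ merges two contexts, identifying shared variables; it is defined only if shared variables have the same type in both: $(\Gamma,x:\sigma)\otimes(\Delta,x:\sigma)=(\Gamma\otimes\Delta),x:\sigma$; $(\Gamma,x:\sigma)\otimes\Delta=(\Gamma\otimes\Delta),x:\sigma$ if $x\notin\mathrm{dom}(\Delta)$; $\bullet\otimes\Delta=\Delta$. Whenever $\otimes$ is used it is assumed defined. **Typing rules** for $\Gamma\vdash t:\sigma$ (strict: every variable must be used, except those of type $\mathcal Q_1$): - (var) $x:\sigma\vdash x:\sigma$; (unit) $\bullet\vdash():\mathcal Q_1$; $\bullet\vdash\mathrm{false}:\mathcal Q_2$; $\bullet\vdash\mathrm{true}:\mathcal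 Q_2$. - (let) from $\Gamma\vdash t:\sigma$ and $\Delta,x:\sigma\vdash u:\tau$ infer $\Gamma\otimes\Delta\vdash\mathbf{let}\ x=t\ \mathbf{in}\ u:\tau$. - ($\otimes$-intro) from $\Gamma\vdash t:\sigma$ and $\Delta\vdash u:\tau$ infer $\Gamma\otimes\Delta\vdash(t,u):\sigma\otimes\tau$. - ($\otimes$-elim) from $\Gamma\vdash t:\sigma\otimes\tau$ and $\Delta,x:\sigma,y:\tau\vdash u:\rho$ infer $\Gamma\otimes\Delta\vdash\mathbf{let}\ (x,y)=t\ \mathbf{in}\ u:\rho$. - ($\mathbf{if}^\circ$) from $\Gamma\vdash c:\mathcal Q_2$ and $\Delta\vdash t,u:\sigma$ infer $\Gamma\otimes\Delta\vdash\mathbf{if}^\circ\ c\ \mathbf{then}\ t\ \mathbf{else}\ u:\sigma$. - (wk-unit) from $\Gamma,x:\mathcal Q_1\vdash t:\sigma$ infer $\Gamma\vdash t:\sigma$, and conversely bindings of variables of type $\mathcal Q_1$ may be added to the context. **Semantics.** $[\![\mathcal Q_1]\!]=\{0\}$, $[\![\mathcal Q_2]\!]=\{0,1\}$, $[\![\sigma\otimes\tau]\!]=[\![\sigma]\!]\times[\![\tau]\!]$. $|\bullet|=\mathcal Q_1$, $|\Gamma,x:\sigma|=|\Gamma|\otimes\sigma$, and $[\![\Gamma]\!]=[\![\,|\Gamma|\,]\!]$ (environments). For $g\in[\![\Gamma\otimes\Delta]\!]$ let $(g_\Gamma,g_\Delta)=\delta_{\Gamma,\Delta}(g)\in[\![\Gamma]\!]\times[\![\Delta]\!]$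 be its two restrictions (values of shared variables are copied). The function $[\![\Gamma\vdash t:\sigma]\!]:[\![\Gamma]\!]\to[\![\sigma]\!]$ is defined by induction on the derivation: $[\![()]\!]0=0$; $[\![\mathrm{false}]\!]0=0$; $[\![\mathrm{true}]\!]0=1$; $[\![x:\sigma\vdash x:\sigma]\!](0,a)=a$; $[\![\mathbf{let}\ x=t\ \mathbf{in}\ u]\!]g=[\![u]\!](g_\Delta,[\![t]\!]g_\Gamma)$; $[\![(t,u)]\!]g=([\![t]\!]g_\Gamma,[\![u]\!]g_\Delta)$; $[\![\mathbf{let}\ (x,y)=t\ \mathbf{in}\ u]\!]g=[\![u]\!]((g_\Delta,a),b)$ where $(a,b)=[\![t]\!]g_\Gamma$; $[\![\mathbf{if}^\circ\ c\ \mathbf{then}\ t\ \mathbf{else}\ u]\!]g$ is $[\![t]\!]g_\Delta$ if $[\![c]\!]g_\Gamma=1$ and $[\![u]\!]g_\Delta$ if $[\![c]\!]g_\Gamma=0$; for wk-unit, $[\![\Gamma\vdash t]\!]g=[\![\Gamma,x:\mathcal Q_1\vdash t]\!](g,0)$. **Classical equations.** Values: $val::=x\mid()\mid\mathrm{false}\mid\mathrm{true}\mid(val_1,val_2)$. - $\mathbf{let}\ p=val\ \mathbf{in}\ u\equiv u[val/p]$. - $\mathbf{let}\ (x,y)=(t,u)\ \mathbf{in}\ e\equiv\mathbf{let}\ x=t\ \mathbf{in}\ \mathbf{let}\ y=u\ \mathbf{in}\ e$; $\mathbf{if}^\circ\ \mathrm{false}\ \mathbf{then}\ t\ \mathbf{else}\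 u\equiv u$; $\mathbf{if}^\circ\ \mathrm{true}\ \mathbf{then}\ t\ \mathbf{else}\ u\equiv t$. - $()\equiv t$ if $t:\mathcal Q_1$; $\mathbf{let}\ x=t\ \mathbf{in}\ x\equiv t$; $\mathbf{let}\ (x,y)=t\ \mathbf{in}\ (x,y)\equiv t$; $\mathbf{if}^\circ\ t\ \mathbf{then}\ \mathrm{true}\ \mathbf{else}\ \mathrm{false}\equiv t$. - $\mathbf{let}\ p=t\ \mathbf{in}\ \mathbf{let}\ q=u\ \mathbf{in}\ e\equiv\mathbf{let}\ q=u\ \mathbf{in}\ \mathbf{let}\ p=t\ \mathbf{in}\ e$; $\mathbf{let}\ p=(\mathbf{if}^\circ\ t\ \mathbf{then}\ u_0\ \mathbf{else}\ u_1)\ \mathbf{in}\ e\equiv\mathbf{if}^\circ\ t\ \mathbf{then}\ (\mathbf{let}\ p=u_0\ \mathbf{in}\ e)\ \mathbf{else}\ (\mathbf{let}\ p=u_1\ \mathbf{in}\ e)$. $\Gamma\vdash t\equiv u:\sigma$ means that $\Gamma\vdash t:\sigma$, $\Gamma\vdash u:\sigma$, and $t\equiv u$ is derivable at type $\sigma$ from these equations by equational reasoning (equivalence and congruence), with the usual conventions avoiding variable capture. *)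

(* Defs.v *)
From HB Require Import structures.
From mathcomp Require Import all_boot.

Set Implicit Arguments.
Unset Strict Implicit.
Unset Printing Implicit Defensive.

Notation var := nat (only parsing).

Inductive ty : Type := Q1 | Q2 | Tens (s1 s2 : ty).

Definition ty_eq_dec : comparable ty.
Proof. by rewrite /comparable /decidable; decide equality. Defined.

HB.instance Definition _ := hasDecEq.Build ty (compareP ty_eq_dec).

Inductive pat : Type := PVar (x : var) | PPair (x y : var).

Inductive term : Type :=
  | Var (x : var)
  | Unit
  | Pair (t u : term)
  | Let (p : pat) (t u : term)
  | If (c t u : term)
  | False_
  | True_.

Fixpoint is_val (t : term) : bool :=
  match t with
  | Var _ | Unit | False_ | True_ => true
  | Pair t1 t2 => is_val t1 && is_val t2
  | _ => false
  end.

(** Contexts: [G, x : s] is [(x, s) :: G].  The lists that occur in derivable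
    judgements never repeat a variable: the rules preserve this. *)
Definition ctx := seq (var * ty).

Definition dom (G : ctx) : seq var := unzip1 G.

Fixpoint merge (G D : ctx) : option ctx :=
  match G with
  | [::] => Some D
  | (x, s) :: G' =>
      if (x, s) \in D then omap (cons (x, s)) (merge G' (rem (x, s) D))
      else if x \in dom D then None
      else omap (cons (x, s)) (merge G' D)
  end.

(** [T_exch] expresses that contexts are finite functions, so that the order
    in which bindings are listed is immaterial. [T_unit_drop] and
    [T_unit_add] are the two directions of the rule wk-unit. *)
Inductive has_type : ctx -> term -> ty -> Type :=
  | T_var x s : has_type [:: (x, s)] (Var x) s
  | T_unit : has_type [::] Unit Q1
  | T_false : has_type [::] False_ Q2
  | T_true : has_type [::] True_ Q2
  | T_let G D E x t u s r :
      merge G D = Some E ->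
      x \notin dom D ->
      has_type G t s ->
      has_type ((x, s) :: D) u r ->
      has_type E (Let (PVar x) t u) r
  | T_pair G D E t u s r :
      merge G D = Some E ->
      has_type G t s ->
      has_type D u r ->
      has_type E (Pair t u) (Tens s r)
  | T_letpair G D E x y t u s1 s2 r :
      merge G D = Some E ->
      x != y -> x \notin dom D -> y \notin dom D ->
      has_type G t (Tens s1 s2) ->
      has_type ((y, s2) :: (x, s1) :: D) u r ->
      has_type E (Let (PPair x y) t u) r
  | T_if G D E c t u s :
      merge G D = Some E ->
      has_type G c Q2 ->
      has_type D t s ->
      has_type D u s ->
      has_type E (If c t u) s
  | T_unit_drop G x t s :
      has_type ((x, Q1) :: G) t s ->
      has_type G t s
  | T_unit_add G x t s :
      x \notin dom G ->
      has_type G t s ->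
      has_type ((x, Q1) :: G) t s
  | T_exch G G' t s :
      perm_eq G G' ->
      has_type G t s ->
      has_type G' t s.

Fixpoint sem (s : ty) : Type :=
  match s with
  | Q1 => unit
  | Q2 => bool
  | Tens s1 s2 => (sem s1 * sem s2)%type
  end.

Fixpoint ctx_ty (G : ctx) : ty :=
  match G with
  | [::] => Q1
  | b :: G' => Tens (ctx_ty G') b.2
  end.

Definition env (G : ctx) : Type := sem (ctx_ty G).

Fixpoint dflt (s : ty) : sem s :=
  match s with
  | Q1 => tt
  | Q2 => false
  | Tens s1 s2 => (dflt s1, dflt s2)
  end.

Definition cast (s r : ty) (a : sem s) : sem r :=
  match ty_eq_dec s r with
  | left e => eq_rect s sem a r e
  | right _ => dflt r
  end.

(** The default value is returned only if [x : s] is not in [G]; this never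
    happens where [restr] is used below. *)
Fixpoint lookup (x : var) (s : ty) (G : ctx) : env G -> sem s :=
  match G return env G -> sem s with
  | [::] => fun _ => dflt s
  | b :: G' => fun g => if x == b.1 then cast s g.2 else lookup x s g.1
  end.

Fixpoint restr (E : ctx) (G : ctx) (g : env E) : env G :=
  match G return env G with
  | [::] => tt
  | b :: G' => (restr G' g, lookup b.1 b.2 g)
  end.

(** The map [delta_{G,D}], for [E] the merge of [G] and [D]. *)
Definition delta (G D E : ctx) (g : env E) : env G * env D :=
  (restr G g, restr D g).

Fixpoint denote (G : ctx) (t : term) (s : ty) (d : has_type G t s) :
    env G -> sem s :=
  match d in has_type G t s return env G -> sem s with
  | T_var _ _ => fun g => g.2
  | T_unit => fun _ => tt
  | T_false => fun _ => false
  | T_true => fun _ => true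
  | T_let G D _ _ _ _ _ _ _ _ dt du => fun g =>
      let: (gG, gD) := delta G D g in
      denote du (gD, denote dt gG)
  | T_pair G D _ _ _ _ _ _ dt du => fun g =>
      let: (gG, gD) := delta G D g in
      (denote dt gG, denote du gD)
  | T_letpair G D _ _ _ _ _ _ _ _ _ _ _ _ dt du => fun g =>
      let: (gG, gD) := delta G D g in
      let: (a, b) := denote dt gG in
      denote du ((gD, a), b)
  | T_if G D _ _ _ _ _ _ dc dt du => fun g =>
      let: (gG, gD) := delta G D g in
      if denote dc gG then denote dt gD else denote du gD
  | T_unit_drop _ _ _ _ dt => fun g => denote dt (g, tt)
  | T_unit_add _ _ _ _ _ dt => fun g => denote dt g.1
  | T_exch G _ _ _ _ dt => fun g => denote dt (restr G g)
  end.

Definition pvars (p : pat) : seq var :=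
  match p with
  | PVar x => [:: x]
  | PPair x y => [:: x; y]
  end.

Fixpoint fv (t : term) : seq var :=
  match t with
  | Var x => [:: x]
  | Unit | False_ | True_ => [::]
  | Pair t u => fv t ++ fv u
  | Let p t u => fv t ++ [seq z <- fv u | z \notin pvars p]
  | If c t u => fv c ++ fv t ++ fv u
  end.

Definition fresh (x : var) (A : seq var) : var :=
  if x \in A then (foldr maxn 0 A).+1 else x.

Definition upd (f : var -> term) (x : var) (v : term) : var -> term :=
  fun z => if z == x then v else f z.

(** Capture-avoiding simultaneous substitution: a bound variable is renamed
    exactly when it would capture a variable of a substituted term. *)
Fixpoint subst (f : var -> term) (t : term) : term :=
  match t with
  | Var x => f x
  | Unit => Unit
  | False_ => False_
  | True_ => True_
  | Pair t u => Pair (subst f t) (subst f u)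
  | If c t u => If (subst f c) (subst f t) (subst f u)
  | Let p t u =>
      let A := flatten [seq fv (f z) | z <- fv u & z \notin pvars p] in
      match p with
      | PVar x =>
          let x' := fresh x A in
          Let (PVar x') (subst f t) (subst (upd f x (Var x')) u)
      | PPair x y =>
          let x' := fresh x A in
          let y' := fresh y (x' :: A) in
          Let (PPair x' y') (subst f t)
              (subst (upd (upd f x (Var x')) y (Var y')) u)
      end
  end.

Definition subst1 (u : term) (x : var) (v : term) : term :=
  subst (upd Var x v) u.

Definition subst2 (u : term) (x : var) (v : term) (y : var) (w : term) : term :=
  subst (upd (upd Var x v) y w) u.

Definition disjoint_vars (A B : seq var) : bool := ~~ has [in B] A.

(** [ceq s t u]: an instance [t = u], at type [s], of one of the classical
    equations.  The typing of both sides is imposed in [cequiv]. *)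
Inductive ceq : ty -> term -> term -> Prop :=
  | E_alpha s x x' t u :
      x' \notin [seq z <- fv u | z != x] ->
      ceq s (Let (PVar x) t u) (Let (PVar x') t (subst1 u x (Var x')))
  | E_alpha_pair s x y x' y' t u :
      x' != y' ->
      disjoint_vars [:: x'; y'] [seq z <- fv u | z \notin [:: x; y]] ->
      ceq s (Let (PPair x y) t u)
            (Let (PPair x' y') t (subst2 u x (Var x') y (Var y')))
  | E_let_val s x v u :
      is_val v ->
      ceq s (Let (PVar x) v u) (subst1 u x v)
  | E_letpair_val s x y v w u :
      is_val v -> is_val w ->
      ceq s (Let (PPair x y) (Pair v w) u) (subst2 u x v y w)
  | E_letpair_pair s x y t u e :
      x \notin fv u ->
      ceq s (Let (PPair x y) (Pair t u) e)
            (Let (PVar x) t (Let (PVar y) u e))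
  | E_if_false s t u : ceq s (If False_ t u) u
  | E_if_true s t u : ceq s (If True_ t u) t
  | E_unit t : ceq Q1 Unit t
  | E_let_eta s x t : ceq s (Let (PVar x) t (Var x)) t
  | E_letpair_eta s x y t :
      ceq s (Let (PPair x y) t (Pair (Var x) (Var y))) t
  | E_if_eta s t : ceq s (If t True_ False_) t
  | E_let_comm s p q t u e :
      disjoint_vars (pvars p) (fv u) ->
      disjoint_vars (pvars q) (fv t) ->
      disjoint_vars (pvars p) (pvars q) ->
      ceq s (Let p t (Let q u e)) (Let q u (Let p t e))
  | E_let_if s p t u0 u1 e :
      ceq s (Let p (If t u0 u1) e) (If t (Let p u0 e) (Let p u1 e)).

(** [cequiv G t u s] is the judgement [G |- t == u : s]: the typed
    congruence generated by [ceq]. *)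
Inductive cequiv : ctx -> term -> term -> ty -> Prop :=
  | C_eq G t u s :
      has_type G t s -> has_type G u s -> ceq s t u -> cequiv G t u s
  | C_refl G t s : has_type G t s -> cequiv G t t s
  | C_sym G t u s : cequiv G t u s -> cequiv G u t s
  | C_trans G t u v s : cequiv G t u s -> cequiv G u v s -> cequiv G t v s
  | C_let G D E x t t' u u' s r :
      merge G D = Some E ->
      x \notin dom D ->
      cequiv G t t' s ->
      cequiv ((x, s) :: D) u u' r ->
      cequiv E (Let (PVar x) t u) (Let (PVar x) t' u') r
  | C_pair G D E t t' u u' s r :
      merge G D = Some E ->
      cequiv G t t' s ->
      cequiv D u u' r ->
      cequiv E (Pair t u) (Pair t' u') (Tens s r)
  | C_letpair G D E x y t t' u u' s1 s2 r :
      merge G D = Some E ->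
      x != y -> x \notin dom D -> y \notin dom D ->
      cequiv G t t' (Tens s1 s2) ->
      cequiv ((y, s2) :: (x, s1) :: D) u u' r ->
      cequiv E (Let (PPair x y) t u) (Let (PPair x y) t' u') r
  | C_if G D E c c' t t' u u' s :
      merge G D = Some E ->
      cequiv G c c' Q2 ->
      cequiv D t t' s ->
      cequiv D u u' s ->
      cequiv E (If c t u) (If c' t' u') s
  | C_unit_drop G x t u s :
      cequiv ((x, Q1) :: G) t u s ->
      cequiv G t u s
  | C_unit_add G x t u s :
      x \notin dom G ->
      cequiv G t u s ->
      cequiv ((x, Q1) :: G) t u s
  | C_exch G G' t u s :
      perm_eq G G' ->
      cequiv G t u s ->
      cequiv G' t u s.

(* Main.v *)
(** A bound variable of type [Q1] may be dropped from the context and the same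
    name reused at another type, so a term does not have one environment in
    which all its variables can be read.  Nevertheless, by strictness, the type
    of every occurrence is forced by the term and its result type: a variable
    not of type [Q1] has to occur at its own type, and can otherwise occur only
    at type [Q1], where its value is irrelevant.  Hence the types of
    let-bound variables can be recomputed from the body, which gives an
    evaluator directed by the result type alone, agreeing with the denotation of
    every derivation.  For this evaluator a substitution lemma holds without
    typing hypotheses. *)

Require Import Defs.
From mathcomp Require Import all_boot.

Set Implicit Arguments.
Unset Strict Implicit.
Unset Printing Implicit Defensive.

(** * Typed environments and the evaluator directed by the result type *)

(** A typed environment gives every variable a value at every type; it is
    only read at the types of the occurrences. *)
Definition tenv : Type := var -> forall s : ty, sem s.

(** Equality of types is decidable, so every proof of [s = s] is trivial and the transport
    disappears. *)
Lemma cast_id (s : ty) (a : sem s) : cast s a = a.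
Proof.
rewrite /cast; case: (ty_eq_dec s s) => [e|//].
by rewrite (eq_axiomK e).
Qed.

(** The default [Q1] is meaningful: [occs] omits occurrences at [Q1], so under strictness a variable
    without a recorded occurrence has type [Q1]. *)
Definition tyof (x : var) (o : ctx) : ty :=
  (head (x, Q1) [seq p <- o | p.1 == x]).2.

Definition removev (A : seq var) (o : ctx) : ctx :=
  [seq p <- o | p.1 \notin A].

(** In the degenerate pattern [(x, x)] the second component shadows the first. *)
Definition patty (p : pat) (o : ctx) : ty :=
  match p with
  | PVar x => tyof x o
  | PPair x y => Tens (tyof x (removev [:: y] o)) (tyof y o)
  end.

(** A read at the type of the bound value makes [cast] the identity; a read at [Q1] yields the only
    point of [sem Q1]. Testing [y] first matches the shadowing in [patty]. *)
Definition proj (p : pat) (s : ty) : sem s -> tenv :=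
  match p with
  | PVar x => fun a _ r => cast r a
  | PPair x y =>
      match s return sem s -> tenv with
      | Tens s1 s2 => fun a z r => if z == y then cast r a.2 else cast r a.1
      | _ => fun _ _ r => dflt r
      end
  end.

Definition bind (p : pat) (s : ty) (a : sem s) (rho : tenv) : tenv :=
  fun z r => if z \in pvars p then proj p a z r else rho z r.

(** Free occurrences with their types.  Those of type [Q1] are left out: their
    variable may be in the context at another type. *)
Fixpoint occs (t : term) (s : ty) : ctx :=
  match t with
  | Var x => if s == Q1 then [::] else [:: (x, s)]
  | Unit | False_ | True_ => [::]
  | Pair t u => if s is Tens s1 s2 then occs t s1 ++ occs u s2 else [::]
  | Let p t u =>
      removev (pvars p) (occs u s) ++ occs t (patty p (occs u s))
  | If c t u => occs c Q2 ++ occs t s ++ occs u s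
  end.

Fixpoint teval (t : term) (s : ty) (rho : tenv) : sem s :=
  match t with
  | Var x => rho x s
  | Unit | False_ => dflt s
  | True_ => match s return sem s with Q2 => true | r => dflt r end
  | Pair t u =>
      match s return sem s with
      | Tens s1 s2 => (teval t s1 rho, teval u s2 rho)
      | r => dflt r
      end
  | Let p t u =>
      teval u s (bind p (teval t (patty p (occs u s)) rho) rho)
  | If c t u => if teval c Q2 rho then teval t s rho else teval u s rho
  end.

Definition consistent (x : var) (o : ctx) : Prop :=
  forall r, (x, r) \in o -> r = tyof x o.

(** The trace that a derivation leaves once contexts are forgotten. Consistency concerns recorded
    occurrences only, so a bound variable may also occur at [Q1]. *)
Fixpoint welltyped (t : term) (s : ty) : Prop :=
  match t with
  | Var _ => True
  | Unit => s = Q1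
  | False_ | True_ => s = Q2
  | Pair t u => if s is Tens s1 s2 then welltyped t s1 /\ welltyped u s2 else False
  | Let p t u =>
      [/\ uniq (pvars p), forall x, x \in pvars p -> consistent x (occs u s),
          welltyped t (patty p (occs u s)) & welltyped u s]
  | If c t u => [/\ welltyped c Q2, welltyped t s & welltyped u s]
  end.

(** * Lists of typed occurrences *)

Lemma dom_mem (o : ctx) p : p \in o -> p.1 \in dom o.
Proof. exact: map_f. Qed.

Lemma tyof_notin x o : x \notin dom o -> tyof x o = Q1.
Proof.
rewrite /tyof; elim: o => //= p o IH; rewrite inE negb_or eq_sym.
by case/andP => /negPf->.
Qed.

Lemma tyof_catl x o o' : x \notin dom o' -> tyof x (o ++ o') = tyof x o.
Proof.
move/tyof_notin; rewrite /tyof filter_cat.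
by case: [seq p <- o | _].
Qed.

Lemma tyof_cons x p o : tyof x (p :: o) = if p.1 == x then p.2 else tyof x o.
Proof. by rewrite /tyof /=; case: ifP. Qed.

Lemma removev_cat A o o' : removev A (o ++ o') = removev A o ++ removev A o'.
Proof. exact: filter_cat. Qed.

Lemma removev_cons A p o :
  removev A (p :: o) = if p.1 \notin A then p :: removev A o else removev A o.
Proof. by []. Qed.

Lemma removev_notin x o : x \notin dom o -> removev [:: x] o = o.
Proof.
move=> xo; apply/all_filterP/allP => p /dom_mem po.
by rewrite inE; apply: contraNneq xo => <-.
Qed.

Lemma tyof_catr x o o' : x \notin dom o -> tyof x (o ++ o') = tyof x o'.
Proof.
elim: o => //= p o IH; rewrite inE negb_or => /andP[xp xo].
by rewrite tyof_cons eq_sym (negPf xp) IH.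
Qed.

Lemma tyof_removev x A o : x \notin A -> tyof x (removev A o) = tyof x o.
Proof.
move=> xA; rewrite /tyof /removev -filter_predI; congr (head _ _).2.
by apply: eq_filter => p /=; case: eqP => //= ->.
Qed.

(** Membership is demanded only for [s <> Q1]; for [s = Q1] an absent variable gets the right type
    by default. *)
Lemma tyof_uniq x s (o : ctx) :
  (forall r, (x, r) \in o -> r = s) -> (s <> Q1 -> (x, s) \in o) ->
  tyof x o = s.
Proof.
rewrite /tyof => h1 h2.
have: forall p, p \in [seq p <- o | p.1 == x] -> p.2 = s.
  by case=> y r; rewrite mem_filter /= => /andP[/eqP-> /h1].
case E: [seq p <- o | p.1 == x] => [|p l] /= h; last first.
  by apply: h; rewrite mem_head.
case: (ty_eq_dec s Q1) => [-> //|/h2 xo].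
have: (x, s) \in [seq p <- o | p.1 == x] by rewrite mem_filter eqxx.
by rewrite E.
Qed.

Lemma removev_nil o : removev [::] o = o.
Proof. exact: filter_predT. Qed.

Lemma removev2 x y o : removev [:: x; y] o = removev [:: x] (removev [:: y] o).
Proof.
rewrite /removev -filter_predI; apply: eq_filter => p /=.
by rewrite !inE negb_or.
Qed.

Lemma mem_removev A o p : (p \in removev A o) = (p.1 \notin A) && (p \in o).
Proof. exact: mem_filter. Qed.

Lemma occs_Q1 t s p : p \in occs t s -> p.2 != Q1.
Proof.
elim: t s p => //= [x|t IHt u IHu|q t IHt u IHu|c IHc t IHt u IHu] s p.
- by case: ifPn => // sQ; rewrite inE => /eqP->.
- by case: s => // s1 s2; rewrite mem_cat => /orP[/IHt|/IHu].
- by rewrite mem_cat mem_removev => /orP[/andP[_ /IHu]|/IHt].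
- by rewrite !mem_cat => /or3P[/IHc|/IHt|/IHu].
Qed.

Lemma occs_fv t s p : p \in occs t s -> p.1 \in fv t.
Proof.
elim: t s p => //= [x|t IHt u IHu|q t IHt u IHu|c IHc t IHt u IHu] s p.
- by case: ifP => // _; rewrite !inE => /eqP->.
- case: s => // s1 s2; rewrite !mem_cat.
  by case/orP=> [/IHt->//|/IHu->]; rewrite orbT.
- rewrite !mem_cat mem_removev mem_filter.
  by case/orP=> [/andP[-> /IHu->]|/IHt->//]; rewrite orbT.
- by rewrite !mem_cat => /or3P[/IHc|/IHt|/IHu]->; rewrite ?orbT.
Qed.

Lemma notin_occs x t s : x \notin fv t -> x \notin dom (occs t s).
Proof. by apply: contra => /mapP[p /occs_fv px ->]. Qed.

(** Reads at [Q1] are not recorded in [occs], but any two environments agree there because [sem Q1]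
    has one point. *)
Lemma teval_ext t s (rho rho' : tenv) :
  (forall x r, (x, r) \in occs t s -> rho x r = rho' x r) ->
  teval t s rho = teval t s rho'.
Proof.
elim: t s rho rho' => //= [x|t IHt u IHu|q t IHt u IHu|c IHc t IHt u IHu] s rho rho' h.
- case: (eqVneq s Q1) h => [->|_] h; first by case: (rho x Q1) (rho' x Q1) => [] [].
  by apply: h; rewrite inE.
- case: s h => //= s1 s2 h; congr (_, _).
    by apply: IHt => x r xr; apply: h; rewrite mem_cat xr.
  by apply: IHu => x r xr; apply: h; rewrite mem_cat xr orbT.
- rewrite (IHt _ rho rho') => [|x r xr]; last by apply: h; rewrite mem_cat xr orbT.
  apply: IHu => x r xr; rewrite /bind; case: ifPn => // xq.
  by apply: h; rewrite mem_cat mem_removev /= xq xr.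
- rewrite (IHc _ rho rho') => [|x r xr]; last by apply: h; rewrite mem_cat xr.
  rewrite (IHt _ rho rho') => [|x r xr]; last by apply: h; rewrite !mem_cat xr orbT.
  by rewrite (IHu _ rho rho') // => x r xr; apply: h; rewrite !mem_cat xr !orbT.
Qed.

Lemma teval_fv t s (rho rho' : tenv) :
  (forall x r, x \in fv t -> rho x r = rho' x r) ->
  teval t s rho = teval t s rho'.
Proof. by move=> h; apply: teval_ext => x r /occs_fv; apply: h. Qed.

(** * Derivable judgements: the context is determined by the occurrences, up to [Q1] *)

Lemma ctx_functional (G : ctx) x s r :
  uniq (dom G) -> (x, s) \in G -> (x, r) \in G -> s = r.
Proof.
elim: G => //= -[y q] G IH /andP[yG uG]; rewrite !inE.
case/orP=> [/eqP[xy sq]|xs] /orP[/eqP[xy' rq]|xr]; first by rewrite sq rq.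
- by move: yG; rewrite -xy (dom_mem xr).
- by move: yG; rewrite -xy' (dom_mem xs).
- exact: IH.
Qed.

Lemma merge_spec G D E :
  uniq (dom G) -> uniq (dom D) -> Defs.merge G D = Some E ->
  uniq (dom E) /\ (forall p, (p \in E) = (p \in G) || (p \in D)).
Proof.
elim: G D E => [|[x s] G IH] D E /=; first by move=> _ uD [<-].
case/andP=> xG uG uD; case: ifPn => xD.
- case E': (Defs.merge G (rem (x, s) D)) => [F|//] [<-] /=.
  have uD' : uniq (dom (rem (x, s) D)).
    by apply: subseq_uniq uD; apply: map_subseq; apply: rem_subseq.
  have [uF memF] := IH _ _ uG uD' E'.
  have remE := mem_rem_uniq (x, s) (map_uniq uD).
  split.
    (* The name [x] cannot recur in the tail: [G] has it once, and a second binding of it in [D]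
       would be [(x, s)] itself, which has been removed. *)
    rewrite uF andbT; apply/mapP => -[[y r]] /=; rewrite memF => h xy.
    subst y; case/orP: h => [/dom_mem xG'|]; first by rewrite (negPf xG) in xG'.
    rewrite remE inE /= => /andP[/eqP ne xr].
    by apply: ne; rewrite (ctx_functional uD xr xD).
  move=> p; rewrite !inE memF remE inE /=.
  by case: (eqVneq p (x, s)) => [->|] //=; rewrite xD.
- case: ifPn => // xnD; case E': (Defs.merge G D) => [F|//] [<-] /=.
  have [uF memF] := IH _ _ uG uD E'.
  split; last by move=> p; rewrite !inE memF orbA.
  rewrite uF andbT; apply/mapP => -[[y r]] /=; rewrite memF => h xy; subst y.
  case/orP: h => /dom_mem /=; first by rewrite (negPf xG).
  by rewrite (negPf xnD).
Qed.

Lemma typed_tyof (G : ctx) o x s :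
  uniq (dom G) -> (forall p, (p \in o) = (p \in G) && (p.2 != Q1)) ->
  (x, s) \in G -> tyof x o = s.
Proof.
move=> uG oG xG; apply: tyof_uniq => [r|/eqP sQ]; rewrite oG ?xG //.
by case/andP=> xr _; apply: ctx_functional uG xr xG.
Qed.

Lemma typed_consistent (G : ctx) o x :
  uniq (dom G) -> (forall p, (p \in o) = (p \in G) && (p.2 != Q1)) ->
  consistent x o.
Proof.
move=> uG oG r; rewrite oG => /andP[xr _].
by rewrite (typed_tyof uG oG xr).
Qed.

(** For passing under a binder: [F] holds the bound variables and [D] shares no name with them, so
    filtering by name removes exactly [F]. *)
Lemma removev_typed A (F D : ctx) o :
  dom F =i A -> {in dom D, forall x, x \notin A} ->
  (forall p, (p \in o) = (p \in F ++ D) && (p.2 != Q1)) ->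
  forall p, (p \in removev A o) = (p \in D) && (p.2 != Q1).
Proof.
move=> FA DA oFD p; rewrite mem_removev oFD mem_cat.
case: (boolP (p \in D)) => [/dom_mem/DA->|_]; first by rewrite orbT.
by rewrite orbF -FA; apply/negbTE; apply/and3P=> -[/negP pF /dom_mem].
Qed.

(** The precise form of strictness. At a binder, [typed_tyof] recovers from the body the type that
    the rule assigned; the two wk-unit rules change the context only at [Q1], which the condition on
    [p.2] hides. *)
Lemma has_type_occs G t s : has_type G t s ->
  [/\ uniq (dom G), forall p, (p \in occs t s) = (p \in G) && (p.2 != Q1)
    & welltyped t s].
Proof.
elim=> {G t s}.
- move=> x s; split=> //= p; case: ifPn => sQ; rewrite !inE.
    by case: eqP => // ->; rewrite sQ.
  by case: eqP => // ->; rewrite sQ.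
- by split.
- by split.
- by split.
- move=> G D E x t u s r mE xD _ [uG oG wt] _ [uxD oxD wu].
  have uD : uniq (dom D) by case/andP: uxD.
  have [uE memE] := merge_spec uG uD mE.
  have tyx : tyof x (occs u r) = s by apply: typed_tyof uxD oxD _; rewrite mem_head.
  split=> //=; last by rewrite tyx; split=> // z _; exact: typed_consistent uxD oxD.
  move=> p; rewrite tyx mem_cat oG (@removev_typed _ [:: (x, s)] D) //.
    by rewrite memE -andb_orl orbC.
  by move=> z zD; rewrite inE; apply: contraNneq xD => <-.
- move=> G D E t u s r mE _ [uG oG wt] _ [uD oD wu].
  have [uE memE] := merge_spec uG uD mE.
  by split=> //= p; rewrite mem_cat oG oD memE andb_orl.
- move=> G D E x y t u s1 s2 r mE xy xD yD _ [uG oG wt] _ [uxD oxD wu].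
  have uD : uniq (dom D) by case/and3P: uxD.
  have [uE memE] := merge_spec uG uD mE.
  have tyy : tyof y (occs u r) = s2 by apply: typed_tyof uxD oxD _; rewrite mem_head.
  have tyx : tyof x (removev [:: y] (occs u r)) = s1.
    rewrite tyof_removev ?inE //.
    by apply: typed_tyof uxD oxD _; rewrite !inE eqxx orbT.
  split=> //=; last first.
    rewrite tyx tyy inE xy; split=> // z _; exact: typed_consistent uxD oxD.
  move=> p; rewrite tyx tyy mem_cat oG.
  rewrite (@removev_typed _ [:: (y, s2); (x, s1)] D) //.
  + by rewrite memE -andb_orl orbC.
  + by move=> z; rewrite !inE orbC.
  + move=> z zD; rewrite !inE negb_or; apply/andP; split.
      by apply: contraNneq xD => <-.
    by apply: contraNneq yD => <-.
- move=> G D E c t u s mE _ [uG oG wc] _ [uD oD wt] _ [_ oD' wu].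
  have [uE memE] := merge_spec uG uD mE.
  by split=> //= p; rewrite !mem_cat oG oD oD' memE orbb andb_orl.
- move=> G x t s _ [/andP[xG uG] oG wt]; split=> // p.
  by rewrite oG inE; case: (eqVneq p (x, Q1)) => //= ->; rewrite andbF.
- move=> G x t s xG _ [uG oG wt]; split=> //=; first by rewrite xG.
  by move=> p; rewrite oG inE; case: (eqVneq p (x, Q1)) => //= ->; rewrite andbF.
- move=> G G' t s GG' _ [uG oG wt]; split=> //.
    by rewrite -(perm_uniq (perm_map _ GG')).
  by move=> p; rewrite oG (perm_mem GG').
Qed.

Lemma has_type_tyof G x s t r :
  has_type G t r -> (x, s) \in G -> tyof x (occs t r) = s.
Proof. by case/has_type_occs=> uG oG _; apply: typed_tyof. Qed.

Lemma has_type_patty G x y s1 s2 t r :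
  x != y -> has_type G t r -> (x, s1) \in G -> (y, s2) \in G ->
  patty (PPair x y) (occs t r) = Tens s1 s2.
Proof.
move=> xy dt xG yG /=; rewrite tyof_removev ?inE //.
by rewrite (has_type_tyof dt xG) (has_type_tyof dt yG).
Qed.

(** * Agreement of the denotation with the evaluator *)

Definition env_tenv (G : ctx) (g : env G) : tenv := fun x s => lookup x s g.

Lemma lookup_restr (E G : ctx) (g : env E) x s :
  uniq (dom G) -> (x, s) \in G -> lookup x s (restr G g) = lookup x s g.
Proof.
elim: G => //= -[y r] G IH /= /andP[yG uG]; rewrite inE.
case: (eqVneq x y) => [xy|xy].
  subst y; case/orP=> [/eqP[->]|/dom_mem /= xG]; first by rewrite cast_id.
  by rewrite xG in yG.
by rewrite xpair_eqE (negPf xy) /=; apply: IH.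
Qed.

(** The right side does not mention [d]. In each rule the environments on the two sides need to
    agree only on recorded occurrences, and these lie in the context of the subterm. *)
Lemma denote_teval G t s (d : has_type G t s) (g : env G) :
  denote d g = teval t s (env_tenv g).
Proof.
(* A premise may be evaluated in the whole environment instead of its restriction; this absorbs
   every use of [delta]. *)
have restrE (E D : ctx) (h : env E) u r : has_type D u r ->
    teval u r (env_tenv (restr D h)) = teval u r (env_tenv h).
  case/has_type_occs=> uD oD _; apply: teval_ext => x q; rewrite oD => /andP[xD _].
  exact: lookup_restr.
elim: d g => {G t s} /=.
- by move=> x s g; rewrite /env_tenv /= eqxx cast_id.
- by [].
- by [].
- by [].
- move=> G D E x t u s r mE xD dt IHt du IHu g.
  have [uxD oxD _] := has_type_occs du.
  rewrite (has_type_tyof du (mem_head _ _)) IHu IHt restrE //.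
  apply: teval_ext => z q; rewrite oxD => /andP[zD _].
  rewrite /env_tenv /bind /= inE; case: eqP => // /eqP zx.
  apply: lookup_restr; first by case/andP: uxD.
  by move: zD; rewrite inE xpair_eqE (negPf zx).
- move=> G D E t u s r mE dt IHt du IHu g.
  by rewrite IHt IHu !restrE.
- move=> G D E x y t u s1 s2 r mE xy xD yD dt IHt du IHu g.
  have [uxD oxD _] := has_type_occs du.
  have xG : (x, s1) \in (y, s2) :: (x, s1) :: D by rewrite !inE eqxx orbT.
  rewrite -/(patty (PPair x y) _) (has_type_patty xy du xG (mem_head _ _)).
  rewrite IHt restrE //; case: (teval t _ _) => a b.
  rewrite IHu; apply: teval_ext => z q; rewrite oxD => /andP[zD _].
  rewrite /env_tenv /bind /= !inE.
  case: (eqVneq z y) => [|zy]; first by rewrite orbT.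
  case: (eqVneq z x) => //= zx.
  apply: lookup_restr; first by case/and3P: uxD.
  by move: zD; rewrite !inE !xpair_eqE (negPf zx) (negPf zy).
- move=> G D E c t u s mE dc IHc dt IHt du IHu g.
  by rewrite IHc IHt IHu !restrE.
- move=> G x t s dt IHt g; rewrite IHt.
  have [/= /andP[xG uG] oG _] := has_type_occs dt.
  apply: teval_ext => z q; rewrite oG inE => /andP[/orP[/eqP[_ ->]//|zG] _].
  rewrite /env_tenv /=; case: eqP => // zx.
  by move: xG; rewrite -zx (dom_mem zG).
- move=> G x t s xG dt IHt g; rewrite IHt.
  have [uG oG _] := has_type_occs dt.
  apply: teval_ext => z q; rewrite oG => /andP[zG _].
  rewrite /env_tenv /=; case: eqP => // zx.
  by move: xG; rewrite -zx (dom_mem zG).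
- by move=> G G' t s GG' dt IHt g; rewrite IHt restrE.
Qed.

(** * Substitution of values *)

Definition occs_comp (f : var -> term) (o : ctx) : ctx :=
  flatten [seq occs (f p.1) p.2 | p <- o].

Lemma occs_comp_cat f o o' : occs_comp f (o ++ o') = occs_comp f o ++ occs_comp f o'.
Proof. by rewrite /occs_comp map_cat flatten_cat. Qed.

Lemma occs_comp_cons f p o :
  occs_comp f (p :: o) = occs (f p.1) p.2 ++ occs_comp f o.
Proof. by []. Qed.

Lemma upd_val f x v : is_val v -> (forall z, is_val (f z)) ->
  forall z, is_val (upd f x v z).
Proof. by move=> vv vf z; rewrite /upd; case: ifP. Qed.

Lemma occs_val_Q1 v : is_val v -> occs v Q1 = [::].
Proof. by case: v. Qed.

(** Since [x'] avoids the images of the other variables, its occurrences after substitution are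
    exactly those of [x] before. Hence renaming a binder preserves its recomputed type. Types other
    than [Q1] ensure that each [Var x'] is recorded. *)
Lemma occs_comp_rename (f : var -> term) (x x' : var) (o : ctx) :
  (forall p, p \in o -> p.2 != Q1) ->
  (forall p, p \in o -> p.1 != x -> x' \notin fv (f p.1)) ->
  tyof x' (occs_comp (upd f x (Var x')) o) = tyof x o /\
  removev [:: x'] (occs_comp (upd f x (Var x')) o) = occs_comp f (removev [:: x] o).
Proof.
elim: o => [|[z r] o IH] oQ ox; first by [].
have [||IH1 IH2] := IH.
- by move=> p po; apply: oQ; rewrite inE po orbT.
- by move=> p po; apply: ox; rewrite inE po orbT.
have rQ := oQ _ (mem_head _ _).
have zx' := ox _ (mem_head _ _).
rewrite occs_comp_cons removev_cat tyof_cons removev_cons inE /=.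
rewrite {1 3}/upd; case: eqP zx' => [->|_] /= zx'.
  by rewrite (negPf rQ) tyof_cons removev_cons inE /= eqxx IH2.
have x'z : x' \notin dom (occs (f z) r) by apply: notin_occs; apply: zx'.
by rewrite tyof_catr // removev_notin // IH1 IH2 occs_comp_cons.
Qed.

(** The single renaming is applied to [y], the outermost update, and then to [x] on the list from
    which [y] has been removed. *)
Lemma occs_comp_rename2 (f : var -> term) (x y x' y' : var) (o : ctx) :
  (forall p, p \in o -> p.2 != Q1) -> x' != y' ->
  (forall p, p \in o -> p.1 \notin [:: x; y] ->
     x' \notin fv (f p.1) /\ y' \notin fv (f p.1)) ->
  let f' := upd (upd f x (Var x')) y (Var y') in
  patty (PPair x' y') (occs_comp f' o) = patty (PPair x y) o /\
  removev [:: x'; y'] (occs_comp f' o) = occs_comp f (removev [:: x; y] o).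
Proof.
move=> oQ xy' fr f'.
have [||ty rm] := @occs_comp_rename (upd f x (Var x')) y y' o => //.
  move=> p po py; rewrite /upd; case: eqP => [_|/eqP px] /=.
    by rewrite inE eq_sym.
  by case: (fr p po) => //; rewrite !inE negb_or px.
have [||tx rmx] := @occs_comp_rename f x x' (removev [:: y] o) => //.
- by move=> p; rewrite mem_removev => /andP[_ /oQ].
- move=> p; rewrite mem_removev inE => /andP[py po] px.
  by case: (fr p po) => //; rewrite !inE negb_or px.
by rewrite !removev2 /= rm ty tx rmx.
Qed.

Lemma fresh_notin x A : fresh x A \notin A.
Proof.
rewrite /fresh; case: ifPn => // _.
have le z : z \in A -> z <= foldr maxn 0 A.
  elim: A => //= y A IH; rewrite inE leq_max => /orP[/eqP->|/IH->].
    by rewrite leqnn.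
  by rewrite orbT.
by apply/negP => /le; rewrite ltnn.
Qed.

Lemma fresh_fv f (A : seq var) p u s x :
  x \notin flatten [seq fv (f z) | z <- fv u & z \notin A] ->
  p \in occs u s -> p.1 \notin A -> x \notin fv (f p.1).
Proof.
move=> xA po pA; apply: contra xA => xf; apply/flatten_mapP.
by exists p.1 => //; rewrite mem_filter pA (occs_fv po).
Qed.

(** Values matter for a variable at [Q1]: its occurrence is not recorded, and a value put in its
    place records nothing at [Q1] either, whereas a conditional could. *)
Lemma occs_subst f t s : (forall z, is_val (f z)) ->
  occs (subst f t) s = occs_comp f (occs t s).
Proof.
elim: t f s => //= [x|t IHt u IHu|q t IHt u IHu|c IHc t IHt u IHu] f s vf.
- case: eqP => [->|_]; first exact: occs_val_Q1.
  by rewrite /occs_comp /= cats0.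
- by case: s => //= s1 s2; rewrite IHt // IHu // occs_comp_cat.
- case: q => [x|x y] /=.
    set x' := fresh _ _.
    have [||ty rm] := @occs_comp_rename f x x' (occs u s).
    + exact: occs_Q1.
    + move=> p po px; apply: fresh_fv po _; first exact: fresh_notin.
      by rewrite inE.
    rewrite IHu; last exact: upd_val.
    by rewrite rm ty IHt // occs_comp_cat.
  set x' := fresh x _; set y' := fresh y _.
  have y'A : y' \notin x' :: _ := fresh_notin y _.
  move: (y'A); rewrite inE negb_or => /andP[y'x' y'f].
  have [|||ty rm] := @occs_comp_rename2 f x y x' y' (occs u s).
  + exact: occs_Q1.
  + by rewrite eq_sym.
  + move=> p po px; split; last exact: fresh_fv po px.
    by apply: fresh_fv po px; exact: fresh_notin.
  rewrite IHu; last by apply: upd_val => //; exact: upd_val.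
  by rewrite rm -/(patty (PPair x' y') _) ty IHt // occs_comp_cat.
- by rewrite IHc // IHt // IHu // !occs_comp_cat.
Qed.

Lemma bind_rename f x x' s (a : sem s) rho z r :
  (z != x -> x' \notin fv (f z)) ->
  teval (upd f x (Var x') z) r (bind (PVar x') a rho) =
  bind (PVar x) a (fun z r => teval (f z) r rho) z r.
Proof.
rewrite /upd /bind /= inE; case: eqP => [_ _|_ fr]; first by rewrite /= inE eqxx.
apply: teval_fv => w q wz; rewrite inE; case: eqP wz (fr isT) => // ->.
by move=> ->.
Qed.

Lemma bind_rename2 f x y x' y' s1 s2 (a : sem (Tens s1 s2)) rho z r :
  x' != y' ->
  (z \notin [:: x; y] -> x' \notin fv (f z) /\ y' \notin fv (f z)) ->
  teval (upd (upd f x (Var x')) y (Var y') z) r (bind (PPair x' y') a rho) =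
  bind (PPair x y) a (fun z r => teval (f z) r rho) z r.
Proof.
move=> xy'; rewrite /upd /bind /= !inE.
case: (eqVneq z y) => [_ _|zy]; first by rewrite /= !inE eqxx !orbT.
case: (eqVneq z x) => [_ _|zx fr]; first by rewrite /= !inE eqxx (negPf xy').
have [fx fy] := fr isT; apply: teval_fv => w q wz; rewrite !inE.
case: (eqVneq w x') wz => [->|_]; first by rewrite (negPf fx).
by case: (eqVneq w y') => // ->; rewrite (negPf fy).
Qed.

(** At a [Let], [occs_subst] and the renaming lemmas show that the renamed binder gets the same
    recomputed type, so both sides bind the same value. *)
Lemma teval_subst f t s rho : (forall z, is_val (f z)) ->
  teval (subst f t) s rho = teval t s (fun z r => teval (f z) r rho).
Proof.
elim: t f s rho => //= [t IHt u IHu|q t IHt u IHu|c IHc t IHt u IHu] f s rho vf.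
- by case: s => //= s1 s2; rewrite IHt // IHu.
- case: q => [x|x y] /=.
    set x' := fresh _ _.
    have fr p : p \in occs u s -> p.1 != x -> x' \notin fv (f p.1).
      move=> po px; apply: fresh_fv po _; first exact: fresh_notin.
      by rewrite inE.
    have vf' := @upd_val f x (Var x') isT vf.
    have [ty _] := occs_comp_rename (@occs_Q1 u s) fr.
    rewrite occs_subst // ty IHu // IHt //; apply: teval_ext => z q zu.
    exact: bind_rename (fr _ zu).
  set x' := fresh x _; set y' := fresh y _.
  have y'A : y' \notin x' :: _ := fresh_notin y _.
  move: (y'A); rewrite inE negb_or => /andP[y'x' y'f].
  have x'y' : x' != y' by rewrite eq_sym.
  have fr p : p \in occs u s -> p.1 \notin [:: x; y] ->
      x' \notin fv (f p.1) /\ y' \notin fv (f p.1).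
    move=> po px; split; last exact: fresh_fv po px.
    by apply: fresh_fv po px; exact: fresh_notin.
  have vf' := @upd_val _ y (Var y') isT (@upd_val f x (Var x') isT vf).
  have [ty _] := occs_comp_rename2 (@occs_Q1 u s) x'y' fr.
  rewrite occs_subst // -/(patty (PPair x' y') _) ty IHu // IHt //.
  apply: teval_ext => z q zu; exact: bind_rename2 (fr _ zu).
- by rewrite IHc // IHt // IHu.
Qed.

(** * Soundness of the equations *)

Lemma disjoint_varsP (A B : seq var) :
  reflect {in A, forall x, x \notin B} (disjoint_vars A B).
Proof. by rewrite /disjoint_vars -all_predC; apply: allP. Qed.

(** For the commuting conversion: [q] neither removes occurrences of variables of [p], nor does [u]
    contribute any. *)
Lemma patty_let p q u s o :
  disjoint_vars (pvars p) (fv u) -> disjoint_vars (pvars p) (pvars q) ->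
  patty p (removev (pvars q) o ++ occs u s) = patty p o.
Proof.
move=> /disjoint_varsP pu /disjoint_varsP pq.
(* The set [A] is empty for a single variable or a second component, and [[:: y]] for a first
   component. *)
have ty x A : x \in pvars p ->
    tyof x (removev A (removev (pvars q) o ++ occs u s)) = tyof x (removev A o).
  move=> xp; rewrite removev_cat tyof_catl; last first.
    apply: contra (notin_occs s (pu x xp)) => /mapP[w].
    by rewrite mem_removev => /andP[_ /dom_mem wu ->].
  rewrite /removev -filter_predI -/(removev A o).
  have -> : [seq w <- o | predI (fun w => w.1 \notin A) (fun w => w.1 \notin pvars q) w]
      = removev (pvars q) (removev A o).
    by rewrite /removev -filter_predI; apply: eq_filter => w /=; rewrite andbC.
  by rewrite tyof_removev // pq.
case: p pu pq ty => [x|x y] pu pq ty /=.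
  by have := ty x [::]; rewrite !removev_nil => -> //; rewrite inE.
congr Tens; first by apply: ty; rewrite inE eqxx.
by have := ty y [::]; rewrite !removev_nil => -> //; rewrite !inE eqxx orbT.
Qed.

Lemma teval_bind_notin p s (a : sem s) rho t r :
  disjoint_vars (pvars p) (fv t) -> teval t r (bind p a rho) = teval t r rho.
Proof.
move=> /disjoint_varsP pt; apply: teval_fv => x q xt; rewrite /bind.
by case: ifP => // /pt; rewrite xt.
Qed.

Lemma disjoint_varsC A B : disjoint_vars A B = disjoint_vars B A.
Proof.
by apply/disjoint_varsP/disjoint_varsP => h x xA; apply/negP => /h; rewrite xA.
Qed.

Lemma disjoint_vars1 x A : x \notin A -> disjoint_vars [:: x] A.
Proof. by move=> xA; apply/disjoint_varsP => y; rewrite inE => /eqP->. Qed.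

(** Typing is needed: the eta laws fail at types other than the expected one,
    and substitution of a value fails if the variable occurs at two types. *)
Lemma ceq_sound s t u rho :
  ceq s t u -> welltyped t s -> teval t s rho = teval u s rho.
Proof.
case=> {s t u} /=.
- move=> s x x' t u x'u _.
  have vV z : is_val (Var z) by [].
  have fr p : p \in occs u s -> p.1 != x -> x' \notin fv (Var p.1).
    move=> po px; rewrite inE; apply: contraNneq x'u => ->.
    by rewrite mem_filter px (occs_fv po).
  have [ty _] := occs_comp_rename (@occs_Q1 u s) fr.
  have vf := @upd_val _ x (Var x') isT vV.
  rewrite /subst1 occs_subst // ty teval_subst //; apply: teval_ext => z q zu.
  by rewrite (bind_rename _ _ _ (fr _ zu)).
- move=> s x y x' y' t u xy' /disjoint_varsP dis _.
  have vV z : is_val (Var z) by [].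
  have fr p : p \in occs u s -> p.1 \notin [:: x; y] ->
      x' \notin fv (Var p.1) /\ y' \notin fv (Var p.1).
    move=> po px; have pu : p.1 \in [seq z <- fv u | z \notin [:: x; y]].
      by rewrite mem_filter px (occs_fv po).
    split; rewrite inE; apply: contraL pu => /eqP <-; apply: dis;
      by rewrite !inE eqxx ?orbT.
  have [ty _] := occs_comp_rename2 (@occs_Q1 u s) xy' fr.
  have vf := @upd_val _ y (Var y') isT (@upd_val _ x (Var x') isT vV).
  rewrite /subst2 occs_subst // -/(patty (PPair x' y') _) ty teval_subst //.
  apply: teval_ext => z q zu.
  by rewrite (bind_rename2 _ _ _ xy' (fr _ zu)).
- move=> s x v u vv [_ cons _ _].
  rewrite /subst1 teval_subst; last exact: upd_val.
  apply: teval_ext => z q zu; rewrite /upd /bind inE; case: eqP => // zx.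
  (* By consistency this occurrence has the type at which [v] was evaluated, so the cast is the
     identity. *)
  subst z; rewrite (cons x _ q zu) ?inE //=; exact: cast_id.
- move=> s x y v w u vv vw [/andP[]]; rewrite inE => xy _ cons _ _.
  rewrite /subst2 teval_subst; last by do 2 apply: upd_val => //.
  apply: teval_ext => z q zu; rewrite /upd /bind !inE /=.
  case: (eqVneq z y) => [zy|zy].
    subst z; rewrite orbT (cons y _ q zu) ?inE ?eqxx ?orbT //; exact: cast_id.
  case: (eqVneq z x) => // zx.
  subst z; rewrite tyof_removev ?inE // (cons x _ q zu) ?inE ?eqxx //=.
  exact: cast_id.
- move=> s x y t u e xu _.
  (* As [x] is not free in [u], the term [u] affects neither the type recomputed for [x] nor its own
     value when [x] is bound first. *)
  rewrite tyof_catl; last exact: notin_occs.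
  rewrite (@teval_bind_notin (PVar x)); last exact: disjoint_vars1.
  apply: teval_ext => z q zu; rewrite /bind !inE /=.
  by case: (eqVneq z y) => _; rewrite ?orbT ?orbF.
- by [].
- by [].
- by move=> t _; case: (teval t _ _).
- move=> s x t _; rewrite /bind inE eqxx /=.
  (* For [s = Q1] the body records nothing, and the default of [tyof] is the right type. *)
  have -> : tyof x (if s == Q1 then [::] else [:: (x, s)]) = s.
    by case: eqP => [->|_] //; rewrite tyof_cons eqxx.
  exact: cast_id.
- move=> s x y t [/andP[]]; rewrite inE => xy _ _ wt.
  (* Well-typedness of the pair in the body forces [s] to be a tensor. *)
  case: s => //= s1 s2 in wt * => _.
  have tyV z r o : tyof z o = Q1 ->
      tyof z ((if r == Q1 then [::] else [:: (z, r)]) ++ o) = r.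
    by case: eqP => [->|_] //; rewrite tyof_cons eqxx.
  have nV z w r : z != w -> z \notin dom (if r == Q1 then [::] else [:: (w, r)]).
    by case: ifP => //= _ zw; rewrite inE.
  have -> : tyof y ((if s1 == Q1 then [::] else [:: (x, s1)]) ++
                    (if s2 == Q1 then [::] else [:: (y, s2)])) = s2.
    rewrite tyof_catr; last by apply: nV; rewrite eq_sym.
    by rewrite -[X in tyof y X]cats0 tyV.
  rewrite tyof_removev ?inE // tyV; last by apply: tyof_notin; exact: nV.
  rewrite /bind !inE !eqxx orbT /= eqxx (negPf xy) !cast_id.
  by case: (teval t _ _).
- by move=> s t [_ sQ _]; subst s => /=; case: (teval t _ _).
- move=> s p q t u e pu qt pq _.
  rewrite !patty_let //; last by rewrite disjoint_varsC.
  rewrite (teval_bind_notin _ _ _ pu) (teval_bind_notin _ _ _ qt).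
  apply: teval_ext => z r _; rewrite /bind.
  case: ifP => // zq; case: ifP => // zp.
  by move/disjoint_varsP: pq => /(_ z zp); rewrite zq.
- by move=> s p t u0 u1 e _; case: (teval t _ _).
Qed.

(** * Soundness of the typed congruence *)

Lemma cequiv_sound G t u s : cequiv G t u s ->
  [/\ inhabited (has_type G t s), inhabited (has_type G u s) &
      forall rho, teval t s rho = teval u s rho].
Proof.
(* Typability of both sides is carried along because the two bodies of a [Let] recompute the bound
   type separately, and only their derivations make the results equal. All [rho] are covered since
   bodies are evaluated under extended environments. *)
elim=> {G t u s}.
- move=> G t u s dt du e; split=> // rho.
  have [_ _ wt] := has_type_occs dt.
  exact: ceq_sound.
- by move=> G t s dt; split.
- by move=> G t u s _ [dt du e]; split.
- by move=> G t u v s _ [dt _ e] _ [_ dv e']; split=> // rho; rewrite e.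
- move=> G D E x t t' u u' s r mE xD _ [[dt] [dt'] et] _ [[du] [du'] eu].
  split=> [||rho].
  + by constructor; apply: T_let mE xD dt du.
  + by constructor; apply: T_let mE xD dt' du'.
  + have xG : (x, s) \in (x, s) :: D by rewrite mem_head.
    by rewrite /= (has_type_tyof du xG) (has_type_tyof du' xG) et eu.
- move=> G D E t t' u u' s r mE _ [[dt] [dt'] et] _ [[du] [du'] eu].
  split=> [||rho].
  + by constructor; apply: T_pair mE dt du.
  + by constructor; apply: T_pair mE dt' du'.
  + by rewrite /= et eu.
- move=> G D E x y t t' u u' s1 s2 r mE xy xD yD _ [[dt] [dt'] et] _ [[du] [du'] eu].
  have xG : (x, s1) \in (y, s2) :: (x, s1) :: D by rewrite !inE eqxx orbT.
  have yG : (y, s2) \in (y, s2) :: (x, s1) :: D by rewrite mem_head.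
  split=> [||rho].
  + by constructor; apply: T_letpair mE xy xD yD dt du.
  + by constructor; apply: T_letpair mE xy xD yD dt' du'.
  + rewrite [LHS]/= [RHS]/= -!/(patty (PPair x y) _).
    by rewrite (has_type_patty xy du xG yG) (has_type_patty xy du' xG yG) et eu.
- move=> G D E c c' t t' u u' s mE _ [[dc] [dc'] ec].
  move=> _ [[dt] [dt'] et] _ [[du] [du'] eu].
  split=> [||rho].
  + by constructor; apply: T_if mE dc dt du.
  + by constructor; apply: T_if mE dc' dt' du'.
  + by rewrite /= ec et eu.
- move=> G x t u s _ [[dt] [du] e].
  by split=> //; constructor; [exact: T_unit_drop dt|exact: T_unit_drop du].
- move=> G x t u s xG _ [[dt] [du] e].
  by split=> //; constructor; apply: T_unit_add.
- move=> G G' t u s GG' _ [[dt] [du] e].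
  by split=> //; constructor; [exact: T_exch GG' dt|exact: T_exch GG' du].
Qed.

Theorem lemma4p2 (G : ctx) (s : ty) (t u : term)
    (Htu : cequiv G t u s)
    (dt : has_type G t s) (du : has_type G u s) :
  denote dt =1 denote du.
Proof.
have [_ _ e] := cequiv_sound Htu.
(* [denote_teval] holds for any derivation, hence for the given [dt] and [du]. *)
by move=> g; rewrite !denote_teval e.
Qed.
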